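(* Let $S$ be a nearly Gorenstein numerical semigroup minimally generated by five integers $n_1<n_2<n_3<n_4<n_5$, and let $(f_1,f_2,f_3,f_4,f_5)$ be an NG-vector for $S$. Assume that $f_1,f_2,f_3$ are pairwise distinct. Then $t(S)\le 5$.
   Context: A numerical semigroup is an additive submonoid $S$ of $\mathbb N=\{0,1,2,\dots\}$ with $\mathbb N\setminus S$ finite. An integer $f\notin S$ is a pseudo-Frobenius number of $S$ if $f+s\in S$ for every $s\in S\setminus\{0\}$; $\operatorname{PF}(S)$ is the set of pseudo-Frobenius numbers and $t(S)=|\operatorname{PF}(S)|$ is the type of $S$. If $n_1<\dots<n_\nu$ are the minimal generators of $S$, a vector $(f_1,\dots,f_\nu)\in\operatorname{PF}(S)^\nu$ is an NG-vector (nearly Gorenstein vector) for $S$ if $n_i+f_i-f\in S$ for every $f\in\operatorname{PF}(S)$ and every $i=1,\dots,\nu$. $S$ is nearly Gorenstein if and only if it admits an NG-vector (an NG-vector need not be unique). *)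

(* Defs.v *)
From mathcomp Require Import all_boot all_order all_algebra finmap.
From mathcomp Require Import mathcomp_extra boolp classical_sets functions cardinality.

Set Implicit Arguments.
Unset Strict Implicit.
Unset Printing Implicit Defensive.

Import Order.TTheory GRing.Theory Num.Theory.
Local Open Scope classical_set_scope.
Local Open Scope ring_scope.

Definition submonoid (S : set nat) : Prop :=
  S 0%N /\ (forall a b : nat, S a -> S b -> S (a + b)%N).

Definition numerical_semigroup (S : set nat) : Prop :=
  submonoid S /\ finite_set (~` S).

Definition generated (A : set nat) : set nat := smallest submonoid A.

Definition minimal_generating_set (S A : set nat) : Prop :=
  generated A = S /\ (forall B : set nat, B `<=` A -> generated B = S -> B = A).

Definition minimal_generators (S : set nat) (n : seq nat) : Prop :=
  sorted ltn n /\ minimal_generating_set S [set` n].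

(* S as a set of integers, so that differences are not truncated. *)
Definition zset (S : set nat) : set int := Posz @` S.

Definition PF (S : set nat) : set int :=
  [set f : int | ~ zset S f /\
                 forall s : nat, S s -> s <> 0%N -> zset S (f + s%:Z)].

(* fset_set is the empty set on infinite sets, but PF S is always finite. *)
Lemma finite_PF (S : set nat) : numerical_semigroup S -> finite_set (PF S).
Proof.
move=> [_ finC].
have [s [Ss s0]] : exists s, S s /\ s <> 0%N.
  apply: contrapT => nex; apply: infinite_nat.
  apply: (@sub_finite_set _ _ (~` S `|` [set 0%N])).
    move=> k _; case: (pselect (k = 0%N)) => [->|k0]; [by right|left].
    by move=> Sk; apply: nex; exists k.
  by rewrite finite_setU; split => //; exact: finite_set1.
apply: (@sub_finite_set _ _ (Posz @` (~` S) `|` Negz @` `I_s)).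
  move=> [k|k] [nS fS]; [left|right]; exists k => //.
    by move=> Sk; apply: nS; exists k.
  have [m _ E] := fS s Ss s0.
  have : (0 <= Negz k + s%:Z)%R by rewrite -E.
  by rewrite NegzE addrC subr_ge0 lez_nat.
by rewrite finite_setU; split; apply: finite_image => //; exact: finite_II.
Qed.

Definition semigroup_type (S : set nat) : nat := #|` fset_set (PF S)|%fset.

(* Meant for n the increasing list of the minimal generators of S. *)
Definition NG_vector (S : set nat) (nu : nat) (n : nu.-tuple nat)
    (f : nu.-tuple int) : Prop :=
  (forall i : 'I_nu, PF S (tnth f i)) /\
  (forall (g : int) (i : 'I_nu),
      PF S g -> zset S ((tnth n i)%:Z + tnth f i - g)).

(* Equivalent to the definition by the trace of the canonical ideal. *)
Definition nearly_Gorenstein (S : set nat) : Prop :=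
  exists (nu : nat) (n : nu.-tuple nat) (f : nu.-tuple int),
    minimal_generators S n /\ NG_vector S n f.

(* Main.v *)
(* Write F = f_1, which is the largest pseudo-Frobenius number. Subtracting F
   in the nearly Gorenstein condition gives f_2 = F - n_2 + l n_1 and
   f_3 = F - n_3 + a n_1 + b n_2 with l > 0, and a > 0 because otherwise
   n_2 + f_2 - f_3 is a multiple of n_1 and n_3 is not a minimal generator.
   Hence F + n_1 - n_2 and F + n_1 - n_3 are not in S, so F + n_1 only factors
   through n_4 and n_5. For g in PF(S) other than f_1, f_2, f_3, the same holds
   for F + n_1 - g = c n_4 + d n_5. If c > 0, then (g + n_4) + s = F + n_1 for
   some s in S, so g + n_4 is a multiple of n_5, and two such g differ by a
   multiple of n_5, hence coincide. Similarly there is at most one g with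
   d > 0. *)
Require Import Defs.
From mathcomp Require Import all_boot all_order all_algebra finmap.
From mathcomp Require Import mathcomp_extra boolp classical_sets functions cardinality.
From mathcomp Require Import zify.

Set Implicit Arguments.
Unset Strict Implicit.
Unset Printing Implicit Defensive.

Import Order.TTheory GRing.Theory Num.Theory.
Local Open Scope classical_set_scope.
Local Open Scope ring_scope.

Lemma generated_submonoid (A : set nat) : submonoid (generated A).
Proof.
split=> [B [[]] //|a b Sa Sb B BA].
by have [[_ BD] _] := BA; apply: BD; [exact: Sa|exact: Sb].
Qed.

(** Otherwise [A] without [x] would still generate [S], against minimality. *)
Lemma minimal_generator_notin (S A : set nat) (x : nat) :
  minimal_generating_set S A -> A x -> ~ generated (A `\ x) x.
Proof.
move=> [genA minA] Ax genx.
suff /(minA _ (@subDsetl _ A [set x])) E : generated (A `\ x) = S.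
  by move: Ax; rewrite -E => -[_]; exact.
rewrite -genA; apply/seteqP; split=> [y geny B [subB AB]|y].
  by apply: geny; split=> // z [/AB].
apply; split; first exact: generated_submonoid.
move=> z Az; have [->//|zx] := eqVneq z x.
by move=> B [_]; apply; split=> //; apply/eqP.
Qed.

Lemma generated_sum (nu : nat) (n : nu.-tuple nat) (x : nat) :
  generated [set` n] x ->
  exists c : 'I_nu -> nat, x = (\sum_i c i * tnth n i)%N.
Proof.
move/(_ [set x | exists c : 'I_nu -> nat, x = (\sum_i c i * tnth n i)%N]).
apply; split; first split.
- by exists (fun=> 0%N); rewrite big1.
- move=> _ _ [c ->] [d ->]; exists (fun i => c i + d i)%N.
  by rewrite -big_split; apply: eq_bigr => i _; rewrite mulnDl.
- move=> y /= /tnthP[i ->]; exists (fun j => (j == i) : nat).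
  by rewrite (bigD1 i)//= eqxx mul1n big1 ?addn0// => j /negbTE ->.
Qed.

Lemma zset_ge0 (S : set nat) (x : int) : zset S x -> 0 <= x.
Proof. by move=> [k _ <-]. Qed.

Lemma zsetD (S : set nat) (x y : int) :
  submonoid S -> zset S x -> zset S y -> zset S (x + y).
Proof.
by move=> subS [a Sa <-] [b Sb <-]; exists (a + b)%N => //; exact: subS.2.
Qed.

Lemma submonoidM (S : set nat) (k a : nat) : submonoid S -> S a -> S (k * a)%N.
Proof.
move=> subS Sa; elim: k => [|k IH]; first exact: subS.1.
by rewrite mulSn; exact: subS.2.
Qed.

Lemma zsetM (S : set nat) (k a : nat) :
  submonoid S -> S a -> zset S (k * a)%N%:Z.
Proof. by move=> subS Sa; exists (k * a)%N => //; exact: submonoidM. Qed.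

(** If [c i] is positive, removing one copy of the [i]-th generator leaves a sum in [S]. This is the
    tool for excluding generators from a factorization. *)
Lemma zset_factor (S : set nat) (nu : nat) (n : nu.-tuple nat) (x : int) :
  submonoid S -> generated [set` n] = S -> zset S x ->
  exists c : 'I_nu -> nat, x = (\sum_i c i * tnth n i)%N%:Z /\
    forall i, ~ zset S (x - (tnth n i)%:Z) -> c i = 0%N.
Proof.
move=> subS genS [m Sm <-].
have Sn j : S (tnth n j) by rewrite -genS => B [_]; apply; exact: mem_tnth.
have [c mE] : exists c : 'I_nu -> nat, m = (\sum_i c i * tnth n i)%N.
  by apply: generated_sum; rewrite genS.
exists c; split=> [|i]; first by rewrite mE.
rewrite mE; case ci: (c i) => [//|k] []; rewrite (bigD1 i)//= ci mulSn.
rewrite -addnA PoszD addrAC subrr add0r PoszD.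
apply: zsetD => //; first exact: zsetM.
exists (\sum_(j < nu | j != i) c j * tnth n j)%N => //.
apply: (big_ind S); [exact: subS.1|exact: subS.2|move=> j _].
exact: submonoidM.
Qed.

Lemma PF_eq (S : set nat) (g h : int) :
  PF S g -> PF S h -> zset S (g - h) -> g = h.
Proof.
move=> [nSg _] [_ Sh] [s Ss sE]; have [s0|s0] := pselect (s = 0%N); first lia.
by case: nSg; rewrite (_ : g = h + s%:Z); [exact: Sh|lia].
Qed.

Lemma PF_eq_mod (S : set nat) (m k l : nat) (g h x : int) :
  submonoid S -> S m -> PF S g -> PF S h ->
  g + x = (k * m)%N -> h + x = (l * m)%N -> g = h.
Proof.
move=> subS Sm; wlog lk : g h k l / (l <= k)%N => [th|] Pg Ph Eg Eh.
  by have [/th|/ltnW/th H] := leqP l k; [exact|exact/esym/H].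
apply: (PF_eq Pg Ph); rewrite (_ : g - h = ((k - l) * m)%N); first exact: zsetM.
by rewrite mulnBl -subzn ?leq_mul2r ?lk ?orbT//; lia.
Qed.

Lemma subset_singleton (T : Type) (x0 : T) (A : set T) :
  (forall x y, A x -> A y -> x = y) -> exists x, A `<=` [set x].
Proof.
move=> Aeq; have [[x Ax]|nA] := pselect (exists x, A x).
  by exists x => y Ay; exact: Aeq.
by exists x0 => y Ay; case: nA; exists y.
Qed.

Lemma card_fset_set_le (T : choiceType) (A : set T) (s : seq T) :
  A `<=` [set` s] -> (#|` fset_set A| <= size s)%N.
Proof.
move=> As; apply: uniq_leq_size; first exact: fset_uniq.
have finA : finite_set A by exact: sub_finite_set As (finite_seq s).
by move=> x; rewrite in_fset_set// inE => /As.
Qed.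

Theorem theorem2p11 (S : set nat) (n : 5.-tuple nat) (f : 5.-tuple int)
  (HS : numerical_semigroup S)
  (HNG : nearly_Gorenstein S)
  (Hn : minimal_generators S n)
  (Hf : NG_vector S n f)
  (H12 : f`_0 <> f`_1) (H13 : f`_0 <> f`_2) (H23 : f`_1 <> f`_2) :
  (semigroup_type S <= 5)%N.
Proof.
have [subS _] := HS; have [sn Hmin] := Hn; have [Pf NG] := Hf.
have genS := Hmin.1.
have Sn j : S (tnth n j) by rewrite -genS => B [_]; apply; exact: mem_tnth.
have fac := fun x => @zset_factor S 5 n x subS genS.
have zD x y := @zsetD S x y subS.
have zM k j := @zsetM S k _ subS (Sn j).
(* Indices start at 0: [i0] stands for the subscript 1, and so on. *)
pose i0 : 'I_5 := inord 0; pose i1 : 'I_5 := inord 1; pose i2 : 'I_5 := inord 2.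
pose i3 : 'I_5 := inord 3; pose i4 : 'I_5 := inord 4.
have sum5 (c : 'I_5 -> nat) : (\sum_i c i * tnth n i = c i0 * tnth n i0 +
    c i1 * tnth n i1 + c i2 * tnth n i2 + c i3 * tnth n i3 + c i4 * tnth n i4)%N.
  rewrite !big_ord_recl big_ord0 addn0 !addnA.
  do !congr (_ + _)%N; congr (c _ * tnth n _)%N; apply: val_inj;
    by rewrite /= inordK.
move: H12 H13 H23.
have -> : f`_0 = tnth f i0 by rewrite (tnth_nth 0) /= inordK.
have -> : f`_1 = tnth f i1 by rewrite (tnth_nth 0) /= inordK.
have -> : f`_2 = tnth f i2 by rewrite (tnth_nth 0) /= inordK.
move=> H12 H13 H23.
have lt_n (i j : 'I_5) : (i < j)%N -> (tnth n i < tnth n j)%N.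
  move=> ij; rewrite !(tnth_nth 0%N).
  by apply: (sorted_ltn_nth ltn_trans) => //; rewrite inE size_tuple.
have n01 : (tnth n i0 < tnth n i1)%N by apply: lt_n; rewrite !inordK.
have n12 : (tnth n i1 < tnth n i2)%N by apply: lt_n; rewrite !inordK.
have n23 : (tnth n i2 < tnth n i3)%N by apply: lt_n; rewrite !inordK.
have n34 : (tnth n i3 < tnth n i4)%N by apply: lt_n; rewrite !inordK.
have irred i : ~ generated ([set` n] `\ tnth n i) (tnth n i).
  by apply: minimal_generator_notin Hmin _; exact: mem_tnth.
have n0gt0 : (0 < tnth n i0)%N.
  rewrite lt0n; apply/eqP => n0; apply: (irred i0); rewrite n0.
  exact: (generated_submonoid _).1.
have irred2 k l : tnth n i2 <> (k * tnth n i0 + l * tnth n i1)%N.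
  have [_ gD] := generated_submonoid ([set` n] `\ tnth n i2).
  have gM j m : tnth n j <> tnth n i2 ->
      generated ([set` n] `\ tnth n i2) (m * tnth n j)%N.
    move=> ji2; apply: (@submonoidM (generated _)).
      exact: generated_submonoid.
    by move=> B [_]; apply; split=> //; exact: mem_tnth.
  by move=> E; apply: (irred i2); rewrite {2}E; apply: gD; apply: gM; lia.
have npos j : tnth n j <> 0%N.
  have [j0|j0] := posnP j; last by have := lt_n i0 j; rewrite inordK//; lia.
  by rewrite (_ : j = i0); [lia|apply: val_inj; rewrite /= inordK].
have PFn g j : PF S g -> zset S (g + (tnth n j)%:Z).
  by move=> [_]; apply; [exact: Sn|exact: npos].
have small g i : PF S g -> g <> tnth f i -> ~ zset S (tnth f i - g).
  by move=> Pg gi /(PF_eq (Pf i) Pg) /esym.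
(* If [f0 < g], then [n0 + f0 - g] is below every generator, hence 0, and [g = f0 + n0] would lie in
   [S]. *)
have f0max g : PF S g -> g <= tnth f i0.
  move=> Pg; rewrite leNgt; apply/negP => f0g.
  have [c []] := fac _ (NG g i0 Pg); rewrite sum5 => cE c0.
  rewrite !c0 in cE; try by move=> /zset_ge0; lia.
  by apply: Pg.1; rewrite (_ : g = tnth f i0 + (tnth n i0)%:Z); [exact: PFn|lia].
have lt10 : tnth f i1 < tnth f i0 by have := f0max _ (Pf i1); lia.
have lt20 : tnth f i2 < tnth f i0 by have := f0max _ (Pf i2); lia.
have nPFn g j : PF S (g + (tnth n j)%:Z) -> ~ PF S g by case=> nS _ /PFn.
have [l f1E] : exists l,
    (tnth n i1)%:Z + tnth f i1 - tnth f i0 = (l * tnth n i0)%N.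
  (* The number is below [n1] because [f1 < f0], so only [n0] can occur in it. *)
  have [c []] := fac _ (NG _ i1 (Pf i0)); rewrite sum5 => cE c0.
  exists (c i0); rewrite cE.
  rewrite (c0 i1) ?(c0 i2) ?(c0 i3) ?(c0 i4) ?mul0n ?addn0//;
    by move=> /zset_ge0; lia.
have l0 : (0 < l)%N.
  rewrite lt0n; apply/eqP => l0; apply: (nPFn (tnth f i1) i1 _ (Pf _)).
  by rewrite (_ : _ + _ = tnth f i0)//; lia.
have [a [b f2E]] : exists a b, (tnth n i2)%:Z + tnth f i2 - tnth f i0 =
    (a * tnth n i0 + b * tnth n i1)%N.
  have [c []] := fac _ (NG _ i2 (Pf i0)); rewrite sum5 => cE c0.
  exists (c i0), (c i1); rewrite cE.
  by rewrite (c0 i2) ?(c0 i3) ?(c0 i4) ?mul0n ?addn0//; move=> /zset_ge0; lia.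
have a0 : (0 < a)%N.
  rewrite lt0n; apply/eqP => a0; rewrite {}a0 mul0n add0n in f2E.
  have b0 : (0 < b)%N.
    rewrite lt0n; apply/eqP => b0; apply: (nPFn (tnth f i2) i2 _ (Pf _)).
    by rewrite (_ : _ + _ = tnth f i0)//; lia.
  have n1b : (tnth n i1 <= b * tnth n i1)%N by rewrite leq_pmull.
  (* As [b > 0], [n1 + f1 - f2] is at most [n2 + f1 - f0 < n2], which leaves [n0] and [n1]; the
     latter is excluded since [f1 - f2] is not in [S]. *)
  have [c []] := fac _ (NG _ i1 (Pf i2)); rewrite sum5 => cE c0.
  have c1 : c i1 = 0%N.
    apply: c0; rewrite (_ : _ - _ = tnth f i1 - tnth f i2); last lia.
    by apply: small => //; apply/nesym.
  rewrite c1 (c0 i2) ?(c0 i3) ?(c0 i4) in cE; try by move=> /zset_ge0; lia.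
  (* This holds since [b * n1 = n2 + f2 - f0 < n2]; it keeps [c i0 - l] from being truncated. *)
  have lc : (l * tnth n i0 <= c i0 * tnth n i0)%N by lia.
  by apply: (irred2 (c i0 - l)%N b); rewrite mulnBl; lia.
(* Each of [f0], [f1], [f2] is [f0 + n0 - n_i] plus an element of [S]: 0, [(l-1) n0] and
   [(a-1) n0 + b n1] respectively. *)
have down i y : (i <= 2)%N ->
    zset S (tnth f i0 + (tnth n i0)%:Z - (tnth n (inord i))%:Z - y) ->
    zset S (tnth f (inord i) - y).
  case: i => [|[|[|//]]] _; rewrite -/i0 -/i1 -/i2 => Sy.
  - by rewrite addrK in Sy.
  - rewrite (_ : tnth f i1 - y = tnth f i0 + (tnth n i0)%:Z - (tnth n i1)%:Z - y +
      (l.-1 * tnth n i0)%N); first exact: zD.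
    by case: l l0 f1E => [//|l] _; rewrite mulSn/=; lia.
  - rewrite (_ : tnth f i2 - y = tnth f i0 + (tnth n i0)%:Z - (tnth n i2)%:Z - y +
      ((a.-1 * tnth n i0)%N%:Z + (b * tnth n i1)%N)).
      by apply: (zD) => //; exact: zD.
    by case: a a0 f2E => [//|a] _; rewrite mulSn/=; lia.
(* If [n_i] with [i <= 2] occurred in [x], then [f0 + n0 - n_i - y] would lie in [S], and by [down]
   so would [f_i - y]. *)
have factor34 x y : zset S x -> x + y = tnth f i0 + (tnth n i0)%:Z ->
    (forall i, (i <= 2)%N -> ~ zset S (tnth f (inord i) - y)) ->
    exists c d : nat, [/\ x = (c * tnth n i3 + d * tnth n i4)%N,
      ~ zset S (x - (tnth n i3)%:Z) -> c = 0%N &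
      ~ zset S (x - (tnth n i4)%:Z) -> d = 0%N].
  move=> Sx xy nSy; have [c []] := fac _ Sx; rewrite sum5 => cE c0.
  exists (c i3), (c i4); split; [|exact: c0|exact: c0].
  have c00 i : (i <= 2)%N -> c (inord i) = 0%N.
    move=> i2le; apply: c0 => Sxi; apply: (nSy i) => //; apply: down => //.
    by rewrite -xy addrAC addrK.
  by rewrite cE (c00 0%N) ?(c00 1%N) ?(c00 2%N).
have factor34S x y : zset S x -> zset S y ->
    x + y = tnth f i0 + (tnth n i0)%:Z ->
    exists c d : nat, [/\ x = (c * tnth n i3 + d * tnth n i4)%N,
      ~ zset S (x - (tnth n i3)%:Z) -> c = 0%N &
      ~ zset S (x - (tnth n i4)%:Z) -> d = 0%N].
  move=> Sx Sy xy; apply: (factor34 _ y) => // i _ Si; apply: (Pf (inord i)).1.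
  by rewrite -(subrK y (tnth f _)); exact: zD.
have nPFK g j : PF S g -> ~ zset S (g + (tnth n j)%:Z - (tnth n j)%:Z).
  by rewrite addrK => -[].
(* The members of this set are all congruent to [-n3] modulo [n4], so there is at most one; if there
   is none, [g3] is an arbitrary integer. *)
have [g3 Pg3] : exists g3, [set g | PF S g /\
    exists k, g + (tnth n i3)%:Z = (k * tnth n i4)%N] `<=` [set g3].
  apply: (subset_singleton 0) => g h [Pg [k Eg]] [Ph [m Eh]].
  exact: (PF_eq_mod subS (Sn i4) Pg Ph Eg Eh).
have [g4 Pg4] : exists g4, [set g | PF S g /\
    exists k, g + (tnth n i4)%:Z = (k * tnth n i3)%N] `<=` [set g4].
  apply: (subset_singleton 0) => g h [Pg [k Eg]] [Ph [m Eh]].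
  exact: (PF_eq_mod subS (Sn i3) Pg Ph Eg Eh).
apply: (@card_fset_set_le _ _ [:: tnth f i0; tnth f i1; tnth f i2; g3; g4]).
move=> g Pg /=; rewrite !inE.
have [//|g0] := eqVneq g (tnth f i0).
have [//|g1] := eqVneq g (tnth f i1).
have [//|g2 /=] := eqVneq g (tnth f i2).
(* Here [y] is [g] itself: [f_i - g] is not in [S] because [g] differs from [f_i]. *)
have [|//|c [d [gE _ _]]] := factor34 _ g (NG g i0 Pg); first lia.
  move=> i i2le; apply: small => //; apply/eqP.
  by case: i i2le => [|[|[|]]].
have [c0|c0] := posnP c.
  have [d0|d0] := posnP d.
    case: (Pg.1); rewrite (_ : g = tnth f i0 + (tnth n i0)%:Z); first exact: PFn.
    by move: gE; rewrite c0 d0; lia.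
  apply/orP; right; apply/eqP/Pg4; split=> //.
  (* Moving one copy of [n4] over to [g] gives a factorization of [f0 + n0] with summand [g + n4].
     Its [n4]-coefficient [m] is 0 as [g] is not in [S], so [g + n4] is a multiple of [n3]. *)
  have [||k [m [kE _ m0]]] := factor34S _ ((c * tnth n i3)%N%:Z +
      (d.-1 * tnth n i4)%N) (PFn g i4 Pg).
  - exact: zD.
  - by case: d d0 gE => [//|d] _; rewrite mulSn/=; lia.
  - by exists k; rewrite kE m0 ?addn0//; exact: nPFK.
apply/orP; left; apply/eqP/Pg3; split=> //.
have [||k [m [kE k0 _]]] := factor34S _ ((c.-1 * tnth n i3)%N%:Z +
    (d * tnth n i4)%N) (PFn g i3 Pg).
- exact: zD.
- by case: c c0 gE => [//|c] _; rewrite mulSn/=; lia.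
- by exists m; rewrite kE k0//; exact: nPFK.
Qed.
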